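(* Let $\sigma^2>0$ and consider the downlink sum AMSE $\bar\xi^{DL}(\mathbf B,\mathbf W)$ and the uplink sum AMSE $\bar\xi^{UL}(\mathbf V,\mathbf T)$ with uplink noise covariance $\sigma^2\mathbf I_N$, as defined in the context. (i) (Downlink to uplink.) Let $\mathbf B=[\mathbf B_1,\dots,\mathbf B_K]$ and $\mathbf W=\mathrm{blkdiag}(\mathbf W_1,\dots,\mathbf W_K)$ be downlink precoders and decoders with $\mathrm{tr}\{\mathbf B^H\mathbf B\}>0$ and $\mathrm{tr}\{\mathbf W^H\mathbf R_n\mathbf W\}>0$. Define $\tilde\beta>0$ by $$\tilde\beta^2=\frac{\sigma^2\,\mathrm{tr}\{\mathbf B^H\mathbf B\}}{\mathrm{tr}\{\mathbf W^H\mathbf R_n\mathbf W\}},$$ and set $\mathbf V=\tilde\beta\,\mathbf W$, $\mathbf T=\mathbf B/\tilde\beta$. Then $\bar\xi^{UL}(\mathbf V,\mathbf T)=\bar\xi^{DL}(\mathbf B,\mathbf W)$ and $\mathrm{tr}\{\mathbf B^H\mathbf B\}=\frac{1}{\sigma^2}\mathrm{tr}\{\mathbf V^H\mathbf R_n\mathbf V\}$. (ii) (Uplink to downlink.) Let $\mathbf V=\mathrm{blkdiag}(\mathbf V_1,\dots,\mathbf V_K)$ and $\mathbf T=[\mathbf T_1,\dots,\mathbf T_K]$ be uplink precoders and decoders with $\mathrm{tr}\{\mathbf V^H\mathbf R_n\mathbf V\}>0$ and $\mathrm{tr}\{\mathbf T^H\mathbf T\}>0$. Define $\beta>0$ by $$\beta^2=\frac{\mathrm{tr}\{\mathbf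 V^H\mathbf R_n\mathbf V\}}{\sigma^2\,\mathrm{tr}\{\mathbf T^H\mathbf T\}},$$ and set $\mathbf B=\beta\,\mathbf T$, $\mathbf W=\mathbf V/\beta$. Then $\bar\xi^{DL}(\mathbf B,\mathbf W)=\bar\xi^{UL}(\mathbf V,\mathbf T)$ and $\mathrm{tr}\{\mathbf B\mathbf B^H\}=\frac{1}{\sigma^2}\mathrm{tr}\{\mathbf V^H\mathbf R_n\mathbf V\}$.
   Context: Positive integers $N,K$ and $M_k,S_k$ ($k=1,\dots,K$) are given, with $M=\sum_k M_k$, $S=\sum_k S_k$. For each $k$ the following are given: a complex matrix $\widehat{\mathbf H}_k\in\mathbb C^{N\times M_k}$ (estimated channel), a real number $\sigma_{ek}^2\ge 0$ (channel estimation error variance), Hermitian positive semidefinite matrices $\mathbf R_{bk}\in\mathbb C^{N\times N}$ and $\mathbf R_{nk}\in\mathbb C^{M_k\times M_k}$ (BS antenna correlation and noise covariance), and a Hermitian positive definite matrix $\widetilde{\mathbf R}_{mk}\in\mathbb C^{M_k\times M_k}$, from which $\mathbf R_{mk}=(\mathbf I_{M_k}+\sigma_{ek}^2\widetilde{\mathbf R}_{mk}^{-1})^{-1}$. Put $\mathbf R_n=\mathrm{blkdiag}(\mathbf R_{n1},\dots,\mathbf R_{nK})$. Downlink: the precoders are $\mathbf B_k\in\mathbb C^{N\times S_k}$, $\mathbf B=[\mathbf B_1,\dots,\mathbf B_K]$, and the decoders are $\mathbf W_k\in\mathbb C^{M_k\times S_k}$, $\mathbf W=\mathrm{blkdiag}(\mathbf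 W_1,\dots,\mathbf W_K)$. The downlink sum average mean-square-error (sum AMSE) is $$\bar\xi^{DL}(\mathbf B,\mathbf W)=S+\sum_{k=1}^K\mathrm{tr}\{\mathbf W_k^H\mathbf\Gamma_k^{DL}\mathbf W_k-\mathbf W_k^H\widehat{\mathbf H}_k^H\mathbf B_k-\mathbf B_k^H\widehat{\mathbf H}_k\mathbf W_k\},$$ $$\mathbf\Gamma_k^{DL}=\widehat{\mathbf H}_k^H\mathbf B\mathbf B^H\widehat{\mathbf H}_k+\sigma_{ek}^2\,\mathrm{tr}\{\mathbf R_{bk}\mathbf B\mathbf B^H\}\mathbf R_{mk}+\mathbf R_{nk}.$$ Virtual uplink: the precoders are $\mathbf V_k\in\mathbb C^{M_k\times S_k}$, $\mathbf V=\mathrm{blkdiag}(\mathbf V_1,\dots,\mathbf V_K)$, and the decoders are $\mathbf T_k\in\mathbb C^{N\times S_k}$, $\mathbf T=[\mathbf T_1,\dots,\mathbf T_K]$. With uplink noise covariance $\sigma^2\mathbf I_N$, the uplink sum AMSE is $$\bar\xi^{UL}(\mathbf V,\mathbf T)=S+\sum_{k=1}^K\Big(\mathrm{tr}\{\mathbf T_k^H\mathbf\Gamma_c\mathbf T_k\}+\sigma^2\mathrm{tr}\{\mathbf T_k^H\mathbf T_k\}-2\,\mathrm{Re}\,\mathrm{tr}\{\mathbf T_k^H\widehat{\mathbf H}_k\mathbf V_k\}\Big),$$ $$\mathbf\Gamma_c=\sum_{i=1}^K\big(\widehat{\mathbf H}_i\mathbf V_i\mathbf V_i^H\widehat{\mathbf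 H}_i^H+\sigma_{ei}^2\,\mathrm{tr}\{\mathbf R_{mi}\mathbf V_i\mathbf V_i^H\}\mathbf R_{bi}\big).$$ *)

(* Defs.v *)
From mathcomp Require Import all_boot all_order all_algebra.
From mathcomp Require Import reals complex.

Set Implicit Arguments.
Unset Strict Implicit.
Unset Printing Implicit Defensive.

Import Order.TTheory GRing.Theory Num.Theory.
Local Open Scope ring_scope.
Local Open Scope sesquilinear_scope.
Local Open Scope complex_scope.

(* The comparisons 0 <= z and 0 < z on R[i] include the condition that z is
   real. *)
Definition psdmx (R : realType) (n : nat) (A : 'M[R[i]]_n) : Prop :=
  A \is hermsymmx /\ forall x : 'cV[R[i]]_n, 0 <= (x ^t* *m A *m x) 0 0.

Definition pdmx (R : realType) (n : nat) (A : 'M[R[i]]_n) : Prop :=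
  A \is hermsymmx /\
  forall x : 'cV[R[i]]_n, x != 0 -> 0 < (x ^t* *m A *m x) 0 0.

(* \mxdiag only covers square blocks; conform_mx recasts A i from
   'M_(m i, n i) to 'M_(m i, n j) when i == j. *)
Definition blkdiag (R : realType) (K : nat) (m n : 'I_K -> nat)
    (A : forall k, 'M[R[i]]_(m k, n k)) :
    'M[R[i]]_((\sum_k m k)%N, (\sum_k n k)%N) :=
  \mxblock_(i, j) (if i == j then conform_mx 0 (A i) else 0).

(* R_m = (I + s2 * Rt^-1)^-1 *)
Definition Rm_of (R : realType) (n : nat) (s2 : R) (Rt : 'M[R[i]]_n) :
    'M[R[i]]_n :=
  invmx (1%:M + s2%:C *: invmx Rt).

Definition GammaDL (R : realType) (N K : nat) (M S : 'I_K -> nat)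
    (H : forall k, 'M[R[i]]_(N, M k)) (se2 : 'I_K -> R)
    (Rb : 'I_K -> 'M[R[i]]_N) (Rm Rn : forall k, 'M[R[i]]_(M k))
    (B : forall k, 'M[R[i]]_(N, S k)) (k : 'I_K) : 'M[R[i]]_(M k) :=
  let Bs := \mxrow_j B j in
  (H k) ^t* *m Bs *m Bs ^t* *m H k
  + ((se2 k)%:C * \tr (Rb k *m Bs *m Bs ^t*)) *: Rm k
  + Rn k.

Definition sumAMSE_DL (R : realType) (N K : nat) (M S : 'I_K -> nat)
    (H : forall k, 'M[R[i]]_(N, M k)) (se2 : 'I_K -> R)
    (Rb : 'I_K -> 'M[R[i]]_N) (Rm Rn : forall k, 'M[R[i]]_(M k))
    (B : forall k, 'M[R[i]]_(N, S k)) (W : forall k, 'M[R[i]]_(M k, S k)) :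
    R[i] :=
  (\sum_k S k)%N%:R
  + \sum_k \tr ((W k) ^t* *m GammaDL H se2 Rb Rm Rn B k *m W k
                - (W k) ^t* *m (H k) ^t* *m B k
                - (B k) ^t* *m H k *m W k).

Definition GammaUL (R : realType) (N K : nat) (M S : 'I_K -> nat)
    (H : forall k, 'M[R[i]]_(N, M k)) (se2 : 'I_K -> R)
    (Rb : 'I_K -> 'M[R[i]]_N) (Rm : forall k, 'M[R[i]]_(M k))
    (V : forall k, 'M[R[i]]_(M k, S k)) : 'M[R[i]]_N :=
  \sum_k (H k *m V k *m (V k) ^t* *m (H k) ^t*
          + ((se2 k)%:C * \tr (Rm k *m V k *m (V k) ^t*)) *: Rb k).

Definition sumAMSE_UL (R : realType) (N K : nat) (M S : 'I_K -> nat)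
    (H : forall k, 'M[R[i]]_(N, M k)) (se2 : 'I_K -> R)
    (Rb : 'I_K -> 'M[R[i]]_N) (Rm : forall k, 'M[R[i]]_(M k)) (sigma2 : R)
    (V : forall k, 'M[R[i]]_(M k, S k)) (T : forall k, 'M[R[i]]_(N, S k)) :
    R[i] :=
  (\sum_k S k)%N%:R
  + \sum_k (\tr ((T k) ^t* *m GammaUL H se2 Rb Rm V *m T k)
            + sigma2%:C * \tr ((T k) ^t* *m T k)
            - 2 * 'Re (\tr ((T k) ^t* *m H k *m V k))).

(* Main.v *)
(* Expanded over pairs of users, both sum AMSEs contain the same terms
   tr(W_k^H H_k^H B_j B_j^H H_k W_k)
     + sigma_ek^2 tr(B_j^H R_bk B_j) tr(W_k^H R_mk W_k),
   only with the order of summation exchanged.  These are homogeneous of degree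
   2 in each of B and W, and the cross terms of degree 1, so the real scaling
   V = c W, T = B / c changes neither.  What remains is to match the downlink
   noise tr(W^H R_n W) with the uplink noise sigma^2 tr(T^H T): multiplied by
   c^2 this is the power identity sigma^2 tr(B^H B) = tr(V^H R_n V), to which
   the definitions of beta and tilde-beta amount. *)
Require Import Defs.
From mathcomp Require Import all_boot all_order all_algebra.
From mathcomp Require Import reals complex.

Set Implicit Arguments.
Unset Strict Implicit.
Unset Printing Implicit Defensive.

Import Order.TTheory GRing.Theory Num.Theory.
Local Open Scope ring_scope.
Local Open Scope sesquilinear_scope.
Local Open Scope complex_scope.

Lemma trmxC_mul (C : numClosedFieldType) m n p
    (A : 'M[C]_(m, n)) (B : 'M[C]_(n, p)) :
  (A *m B) ^t* = B ^t* *m A ^t*.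
Proof. by rewrite trmx_mul map_mxM. Qed.

Lemma trmxC_realZ (R : rcfType) m n (c : R) (A : 'M[R[i]]_(m, n)) :
  (c%:C *: A) ^t* = c%:C *: A ^t*.
Proof. by rewrite linearZ map_mxZ; congr (_ *: _); exact: conjc_real. Qed.

Lemma mxtrace_form_realZ (R : rcfType) m n (c : R) (Q : 'M[R[i]]_m)
    (A : 'M[R[i]]_(m, n)) :
  \tr ((c%:C *: A) ^t* *m Q *m (c%:C *: A)) =
  c%:C ^+ 2 * \tr (A ^t* *m Q *m A).
Proof.
by rewrite trmxC_realZ -scalemxAr -!scalemxAl scalerA linearZ.
Qed.

Lemma mxtrace_gram_realZ (R : rcfType) m n (c : R) (A : 'M[R[i]]_(m, n)) :
  \tr ((c%:C *: A) ^t* *m (c%:C *: A)) = c%:C ^+ 2 * \tr (A ^t* *m A).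
Proof. by rewrite trmxC_realZ -scalemxAr -scalemxAl scalerA linearZ. Qed.

Lemma mxtrace_trmxC (C : numClosedFieldType) n (A : 'M[C]_n) :
  \tr (A ^t*) = ((\tr A)^*)%R.
Proof. by rewrite trace_map_mx mxtrace_tr. Qed.

Lemma trmxC_mxrow (C : numClosedFieldType) N K (S : 'I_K -> nat)
    (B : forall k, 'M[C]_(N, S k)) :
  (\mxrow_k B k) ^t* = \mxcol_k (B k) ^t*.
Proof. by apply/matrixP => i j; rewrite !mxE. Qed.

Lemma mul_mxrow_trmxC (C : numClosedFieldType) N K (S : 'I_K -> nat)
    (B : forall k, 'M[C]_(N, S k)) :
  (\mxrow_k B k) *m (\mxrow_k B k) ^t* = \sum_k B k *m (B k) ^t*.
Proof. by rewrite trmxC_mxrow mul_mxrow_mxcol. Qed.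

Lemma mxtrace_gram_mxrow (C : numClosedFieldType) N K (S : 'I_K -> nat)
    (B : forall k, 'M[C]_(N, S k)) :
  \tr ((\mxrow_k B k) ^t* *m (\mxrow_k B k)) = \sum_k \tr ((B k) ^t* *m B k).
Proof.
rewrite mxtrace_mulC mul_mxrow_trmxC linear_sum.
by apply: eq_bigr => k _; rewrite mxtrace_mulC.
Qed.

(** Off-diagonal blocks of [blkdiag W] vanish, so only diagonal blocks contribute to the trace. This
    splits the noise and power terms of the theorem into per-user sums. *)
Lemma mxtrace_blkdiag_form (R : realType) (K : nat) (M S : 'I_K -> nat)
    (Q : forall k, 'M[R[i]]_(M k)) (W : forall k, 'M[R[i]]_(M k, S k)) :
  \tr ((blkdiag W) ^t* *m (\mxdiag_k Q k) *m blkdiag W) =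
  \sum_k \tr ((W k) ^t* *m Q k *m W k).
Proof.
have blkC : (blkdiag W) ^t* =
    \mxblock_(i, j) (if j == i then conform_mx 0 (W j) else 0) ^t*.
  by apply/matrixP => i j; rewrite !mxE.
rewrite blkC mul_mxblock_mxdiag mul_mxblock mxtrace_mxblock.
(* In the inner sum only the index equal to [i] survives; there the recast is between equal sizes
   and drops out. *)
apply: eq_bigr => i _; rewrite (bigD1 i) //= eqxx conform_mx_id.
by rewrite big1 ?addr0 // => j /negbTE->; rewrite mulmx0.
Qed.

Section Duality.

Variables (R : realType) (N K : nat) (M S : 'I_K -> nat).
Variables (H : forall k, 'M[R[i]]_(N, M k)) (se2 : 'I_K -> R).
Variables (Rb : 'I_K -> 'M[R[i]]_N) (Rm Rn : forall k, 'M[R[i]]_(M k)).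
Implicit Types (V W : forall k, 'M[R[i]]_(M k, S k)).
Implicit Types (B T : forall k, 'M[R[i]]_(N, S k)).

(** In both links [k] is the user whose channel is traversed and [j] the user whose matrix acts at
    the base station: [k] receives in the downlink and transmits in the uplink. *)
Definition leakage B W (k j : 'I_K) : R[i] :=
  \tr ((W k) ^t* *m (H k) ^t* *m B j *m (B j) ^t* *m H k *m W k)
  + (se2 k)%:C * \tr ((B j) ^t* *m Rb k *m B j)
    * \tr ((W k) ^t* *m Rm k *m W k).

Definition cross_term B W (k : 'I_K) : R[i] := \tr ((B k) ^t* *m H k *m W k).

Lemma sumAMSE_DLE B W :
  sumAMSE_DL H se2 Rb Rm Rn B W =
  (\sum_k S k)%N%:R
  + (\sum_k \sum_j leakage B W k j
     + \sum_k \tr ((W k) ^t* *m Rn k *m W k)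
     - \sum_k (cross_term B W k + ((cross_term B W k)^*)%R)).
Proof.
rewrite /sumAMSE_DL; congr (_ + _).
rewrite -big_split -sumrB /=; apply: eq_bigr => k _.
rewrite !linearB /= /GammaDL [cross_term B W k + _]addrC opprD addrA.
congr (_ - _ - _).
  (* Regrouping exposes the product of the stacked precoder with its conjugate transpose, which is
     the sum of the per-user products; the double sum comes from it. *)
  rewrite -[X in X *m H k + _]mulmxA -[X in _ * \tr X]mulmxA mul_mxrow_trmxC.
  rewrite !(mulmxDl, mulmxDr) !linearD /=; congr (_ + _).
  rewrite big_split /=; congr (_ + _).
    rewrite mulmx_sumr mulmx_suml mulmx_sumr mulmx_suml linear_sum /=.
    by apply: eq_bigr => j _; rewrite !mulmxA.
  rewrite -scalemxAr -scalemxAl linearZ /= mulmx_sumr linear_sum /=.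
  rewrite [X in X * _]mulr_sumr mulr_suml; apply: eq_bigr => j _.
  by rewrite mulmxA mxtrace_mulC mulmxA.
(* The two downlink cross terms are traces of mutually conjugate-transposed matrices. *)
by rewrite -mxtrace_trmxC !trmxC_mul trmxCK mulmxA.
Qed.

Lemma sumAMSE_ULE (sigma2 : R) V T :
  sumAMSE_UL H se2 Rb Rm sigma2 V T =
  (\sum_k S k)%N%:R
  + (\sum_k \sum_j leakage T V k j
     + sigma2%:C * \sum_k \tr ((T k) ^t* *m T k)
     - \sum_k (cross_term T V k + ((cross_term T V k)^*)%R)).
Proof.
rewrite /sumAMSE_UL; congr (_ + _).
(* The uplink error sums first over the decoder index, which is the second index of [leakage]. *)
rewrite exchange_big mulr_sumr -big_split -sumrB /=; apply: eq_bigr => j _.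
congr (_ + _ - _); last by rewrite ReE mulrC divfK ?pnatr_eq0.
rewrite /GammaUL mulmx_sumr mulmx_suml linear_sum /=.
apply: eq_bigr => k _; rewrite mulmxDr mulmxDl linearD /=; congr (_ + _).
  by rewrite !mulmxA -!(mulmxA ((T j) ^t* *m H k *m V k)) mxtrace_mulC !mulmxA.
rewrite -scalemxAr -scalemxAl linearZ /= -!mulrA; congr (_ * _).
by rewrite mulrC; congr (_ * _); rewrite mxtrace_mulC mulmxA.
Qed.

(** Both directions of the theorem are instances: [c] is tilde-beta in one and beta in the other.
    Writing [B] and [V] as multiples of [T] and [W] keeps inverses out of the computation. *)
Lemma sumAMSE_duality (sigma2 c : R) B W V T : c != 0 ->
    (forall k, V k = c%:C *: W k) -> (forall k, B k = c%:C *: T k) ->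
    sigma2%:C * \sum_k \tr ((B k) ^t* *m B k) =
      \sum_k \tr ((V k) ^t* *m Rn k *m V k) ->
  sumAMSE_UL H se2 Rb Rm sigma2 V T = sumAMSE_DL H se2 Rb Rm Rn B W.
Proof.
move=> c0 VE BE power; rewrite sumAMSE_ULE sumAMSE_DLE.
have cC : c%:C != 0 by rewrite fmorph_eq0.
congr (_ + (_ + _ - _)).
(* Both sides are reduced to expressions in [T] and [W], each carrying the factor [c] twice. *)
- apply: eq_bigr => k _; apply: eq_bigr => j _; rewrite /leakage VE BE.
  rewrite !trmxC_realZ; do !(rewrite -scalemxAl || rewrite -scalemxAr).
  rewrite !linearZ /=; congr (_ + _).
  rewrite !mulrA; congr (_ * _).
  by rewrite [RHS]mulrAC; congr (_ * _); rewrite mulrAC.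
- apply: (mulfI (expf_neq0 2 cC)); rewrite mulrCA.
  move: power; under eq_bigr do rewrite BE mxtrace_gram_realZ.
  under [in RHS]eq_bigr do rewrite VE mxtrace_form_realZ.
  by rewrite -!mulr_sumr.
apply: eq_bigr => k _; suff -> : cross_term T V k = cross_term B W k by [].
by rewrite /cross_term VE BE trmxC_realZ -!scalemxAl -scalemxAr.
Qed.

End Duality.

Theorem mainTheorem1 (R : realType) (N K : nat) (M S : 'I_K -> nat)
    (N_gt0 : (0 < N)%N) (K_gt0 : (0 < K)%N)
    (M_gt0 : forall k, (0 < M k)%N) (S_gt0 : forall k, (0 < S k)%N)
    (H : forall k, 'M[R[i]]_(N, M k))
    (se2 : 'I_K -> R) (se2_ge0 : forall k, 0 <= se2 k)
    (Rb : 'I_K -> 'M[R[i]]_N) (Rb_psd : forall k, psdmx (Rb k))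
    (Rn : forall k, 'M[R[i]]_(M k)) (Rn_psd : forall k, psdmx (Rn k))
    (Rmt : forall k, 'M[R[i]]_(M k)) (Rmt_pd : forall k, pdmx (Rmt k))
    (sigma2 : R) (sigma2_gt0 : 0 < sigma2) :
  let Rm k := Rm_of (se2 k) (Rmt k) in
  let Rnd := \mxdiag_k Rn k in
  let xiDL := sumAMSE_DL (S := S) H se2 Rb Rm Rn in
  let xiUL := sumAMSE_UL (S := S) H se2 Rb Rm sigma2 in
  (forall (B : forall k, 'M[R[i]]_(N, S k))
          (W : forall k, 'M[R[i]]_(M k, S k)),
     let Bs := \mxrow_k B k in
     let Wd := blkdiag W in
     0 < \tr (Bs ^t* *m Bs) ->
     0 < \tr (Wd ^t* *m Rnd *m Wd) ->
     forall tbeta : R, 0 < tbeta ->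
     tbeta%:C ^+ 2 =
       sigma2%:C * \tr (Bs ^t* *m Bs) / \tr (Wd ^t* *m Rnd *m Wd) ->
     let V k := tbeta%:C *: W k in
     let T k := tbeta%:C^-1 *: B k in
     let Vd := blkdiag V in
     xiUL V T = xiDL B W /\
     \tr (Bs ^t* *m Bs) = sigma2%:C^-1 * \tr (Vd ^t* *m Rnd *m Vd))
  /\
  (forall (V : forall k, 'M[R[i]]_(M k, S k))
          (T : forall k, 'M[R[i]]_(N, S k)),
     let Vd := blkdiag V in
     let Ts := \mxrow_k T k in
     0 < \tr (Vd ^t* *m Rnd *m Vd) ->
     0 < \tr (Ts ^t* *m Ts) ->
     forall beta : R, 0 < beta ->
     beta%:C ^+ 2 =
       \tr (Vd ^t* *m Rnd *m Vd) / (sigma2%:C * \tr (Ts ^t* *m Ts)) ->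
     let B k := beta%:C *: T k in
     let W k := beta%:C^-1 *: V k in
     let Bs := \mxrow_k B k in
     xiDL B W = xiUL V T /\
     \tr (Bs *m Bs ^t*) = sigma2%:C^-1 * \tr (Vd ^t* *m Rnd *m Vd)).
Proof.
move=> Rm Rnd xiDL xiUL; have s0 : sigma2%:C != 0.
  by rewrite fmorph_eq0 gt_eqF.
split=> [B W Bs Wd _ W0 c c0 cE V T Vd | V T Vd Ts _ T0 c c0 cE B W Bs].
- have cn0 : c%:C != 0 by rewrite fmorph_eq0 gt_eqF.
  have power : sigma2%:C * \tr (Bs ^t* *m Bs) = \tr (Vd ^t* *m Rnd *m Vd).
    rewrite [RHS]mxtrace_blkdiag_form.
    under [RHS]eq_bigr do rewrite mxtrace_form_realZ.
    (* The denominator of tilde-beta squared cancels because [W0] makes it nonzero. *)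
    by rewrite -mulr_sumr -mxtrace_blkdiag_form cE divfK // gt_eqF.
  split; last by rewrite -power mulKf.
  apply: (@sumAMSE_duality _ _ _ _ _ _ _ _ _ _ _ c) => // [|k|].
  + by rewrite gt_eqF.
  + by rewrite scalerA divff ?scale1r.
  + by rewrite -mxtrace_gram_mxrow -mxtrace_blkdiag_form.
- have cn0 : c%:C != 0 by rewrite fmorph_eq0 gt_eqF.
  have power : sigma2%:C * \tr (Bs ^t* *m Bs) = \tr (Vd ^t* *m Rnd *m Vd).
    rewrite mxtrace_gram_mxrow.
    under [X in _ * X = _]eq_bigr do rewrite mxtrace_gram_realZ.
    rewrite -mulr_sumr -mxtrace_gram_mxrow cE mulrCA divfK //.
    by rewrite mulf_neq0 // gt_eqF.
  split; last by rewrite mxtrace_mulC -power mulKf.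
  (* Here [B] is a multiple of [T] by definition, and [V] is recovered from [W] by undoing the
     division by [c]. *)
  apply/esym/(@sumAMSE_duality _ _ _ _ _ _ _ _ _ _ _ c) => // [|k|].
  + by rewrite gt_eqF.
  + by rewrite scalerA divff ?scale1r.
  + by rewrite -mxtrace_gram_mxrow -mxtrace_blkdiag_form.
Qed.
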